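(* Let $E,m\ge1$, let $x,x'\in\mathbb{F}^E_m\cap[0,1]$ satisfy $0<x-x'<1$ (exact real subtraction), and let $\ell\ge1$ be an integer. Let $\beta=(n_1,n_2,n_{\mathrm{hi}},n_{\mathrm{lo}},b_1,b_2,g_{\mathrm{hi}},g_{\mathrm{lo}})=\textsc{Pre1}(x,x')$ and $b'=\textsc{ExtractBit}(\beta,\ell)$, with the procedures defined in the context. Then $0\le g_{\mathrm{hi}}<2^{n_{\mathrm{hi}}}$, $0\le g_{\mathrm{lo}}<2^{n_{\mathrm{lo}}}$, and $x-x'=(0.\,\underbrace{b_1\ldots b_1}_{n_1}\,[g_{\mathrm{hi}}]_{n_{\mathrm{hi}}}\,\underbrace{b_2\ldots b_2}_{n_2}\,[g_{\mathrm{lo}}]_{n_{\mathrm{lo}}})_2$, where $[g]_k$ denotes the $k$-digit binary representation of $g$ (with leading zeros); moreover $b'$ is the $\ell$-th digit after the binary point of the concise binary expansion of $x-x'$, and all intermediate values appearing in $\textsc{Pre1}$ and $\textsc{ExtractBit}$ are representable as $(1+E+m)$-bit signed integers.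
   Context: $\mathbb{F}^E_m$ is the IEEE-754 floating-point format with bit strings $s\,e_E\ldots e_1\,f_1\ldots f_m$, bias $b_E=2^{E-1}-1$, $e=(e_E\ldots e_1)_2$; finite nonnegative values are $(0.f_1\ldots f_m)_2\,2^{1-b_E}$ if $e=0$ and $(1.f_1\ldots f_m)_2\,2^{e-b_E}$ if $0<e<2^E-1$. A concise binary expansion does not end in infinitely many 1s. $\textsc{Pre1}(x,x')$: let $e,e'$ be the exponent fields of $x,x'$ and $f_i,f'_i$ their mantissa bits. Set $\hat e=e-(2^{E-1}-1)+\mathbf{1}[e=0]$, $\hat e'=e'-(2^{E-1}-1)+\mathbf{1}[e'=0]$, $f=(1f_1\ldots f_m)_2-\mathbf{1}[e=0]2^m$, $f'=(1f'_1\ldots f'_m)_2-\mathbf{1}[e'=0]2^m$, $d=\hat e-\hat e'$, $f'_{\mathrm{hi}}=\lfloor f'/2^{\min\{d,E+m\}}\rfloor$, $f'_{\mathrm{lo}}=f'\bmod 2^{\min\{d,m+1\}}$, $n_1=-\hat e-1+\mathbf{1}[x=1]$, $n_2=\max\{d-(m+1),0\}$, $n_{\mathrm{hi}}=m+1-\mathbf{1}[x=1]$, $n_{\mathrm{lo}}=\min\{d,m+1\}$, $b_1=0$, $b_2=\mathbf{1}[f'_{\mathrm{lo}}>0]$, $g_{\mathrm{hi}}=f-f'_{\mathrm{hi}}-b_2$, $g_{\mathrm{lo}}=b_2\,2^{n_{\mathrm{lo}}}-f'_{\mathrm{lo}}$; return $(n_1,n_2,n_{\mathrm{hi}},n_{\mathrm{lo}},b_1,b_2,g_{\mathrm{hi}},g_{\mathrm{lo}})$.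 $\textsc{ExtractBit}(\beta,\ell)$: if $\ell\le n_1$ return $b_1$; else if $\ell\le n_1+n_{\mathrm{hi}}$ return the $(\ell-n_1)$-th most significant digit of $[g_{\mathrm{hi}}]_{n_{\mathrm{hi}}}$; else if $\ell\le n_1+n_{\mathrm{hi}}+n_2$ return $b_2$; else if $\ell\le n_1+n_{\mathrm{hi}}+n_2+n_{\mathrm{lo}}$ return the $(\ell-n_1-n_{\mathrm{hi}}-n_2)$-th most significant digit of $[g_{\mathrm{lo}}]_{n_{\mathrm{lo}}}$; else return $0$.
   Formalization: If n_1<0 (possible for E≤2) the string is read as shifted left by −n_1 places; divisor and modulus powers of two are not counted as intermediate values (2^{min{d,E+m}} may be 2^{E+m}, not representable), and trivially bounded terms such as (1f_1…f_m)_2 are not listed. *)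

(* Defs.v *)
From HB Require Import structures.
From mathcomp Require Import all_boot all_order all_algebra.
From mathcomp Require Import all_classical all_reals all_analysis.
Set Implicit Arguments. Unset Strict Implicit. Unset Printing Implicit Defensive.
Import Order.TTheory GRing.Theory Num.Theory numFieldNormedType.Exports.
Local Open Scope classical_set_scope.
Local Open Scope ring_scope.

Definition bias (E : nat) : int := (2 ^ E.-1)%N%:Z - 1.

(* Value of the IEEE bit string  s e_E..e_1 f_1..f_m  with exponent field
   e = (e_E..e_1)_2 and mantissa field F = (f_1..f_m)_2, for 0 <= e < 2^E - 1. *)
Definition fval (R : realType) (E m : nat) (s : bool) (e F : nat) : R :=
  (-1) ^+ s *
  (if e == 0%N then (F%:R / 2 ^+ m) * (2 : R) ^ (1 - bias E)
   else ((2 ^ m + F)%N%:R / 2 ^+ m) * (2 : R) ^ (e%:Z - bias E)).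

(* 2^k as an integer (k >= 0 in all uses) *)
Definition p2 (k : int) : int := (2 ^ absz k)%N%:Z.

Record pre1_out := Pre1Out
  { n1 : int; n2 : int; nhi : int; nlo : int;
    b1 : int; b2 : int; ghi : int; glo : int }.

Section Pre1.
Variables (E m : nat) (x_is_one : bool) (e F e' F' : nat).
Definition ind (b : bool) : int := (nat_of_bool b)%:Z.
Definition ehat : int := e%:Z - bias E + ind (e == 0%N).
Definition ehat' : int := e'%:Z - bias E + ind (e' == 0%N).
Definition fint : int := (2 ^ m + F)%N%:Z - ind (e == 0%N) * (2 ^ m)%N%:Z.
Definition fint' : int := (2 ^ m + F')%N%:Z - ind (e' == 0%N) * (2 ^ m)%N%:Z.
Definition dd : int := ehat - ehat'.
Definition shi : int := Order.min dd (E + m)%N%:Z.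
Definition slo : int := Order.min dd (m.+1)%:Z.
Definition fhi' : int := divz fint' (p2 shi).
Definition flo' : int := modz fint' (p2 slo).
Definition pn1 : int := - ehat - 1 + ind x_is_one.
Definition pn2 : int := Order.max (dd - (m.+1)%:Z) 0.
Definition pnhi : int := (m.+1)%:Z - ind x_is_one.
Definition pnlo : int := slo.
Definition pb1 : int := 0.
Definition pb2 : int := ind (0 < flo').
Definition pghi : int := fint - fhi' - pb2.
Definition pglo : int := pb2 * p2 pnlo - flo'.

Definition pre1 : pre1_out :=
  Pre1Out pn1 pn2 pnhi pnlo pb1 pb2 pghi pglo.

(* All intermediate values computed by Pre1 (powers of two used only as
   shift amounts are not listed, except the product b2 * 2^nlo). *)
Definition pre1_intermediates : seq int :=
  [:: e%:Z; e'%:Z; bias E; e%:Z - bias E; e'%:Z - bias E; ehat; ehat';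
      fint; fint'; dd; shi; slo; fhi'; flo';
      - ehat; - ehat - 1; pn1; dd - (m.+1)%:Z; pn2; pnhi; pnlo; pb1; pb2;
      fint - fhi'; pghi; pb2 * p2 pnlo; pglo].
End Pre1.

Definition digit (g k j : int) : int := modz (divz g (p2 (k - j))) 2.

Definition bits (g k : int) : seq int :=
  [seq digit g k (i.+1)%:Z | i <- iota 0 (absz k)].

Definition extract_bit (b : pre1_out) (l : int) : int :=
  if l <= n1 b then b1 b
  else if l <= n1 b + nhi b then digit (ghi b) (nhi b) (l - n1 b)
  else if l <= n1 b + nhi b + n2 b then b2 b
  else if l <= n1 b + nhi b + n2 b + nlo b
       then digit (glo b) (nlo b) (l - n1 b - nhi b - n2 b)
  else 0.

Definition extract_intermediates (b : pre1_out) (l : int) : seq int :=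
  let s1 := n1 b + nhi b in
  let s2 := n1 b + nhi b + n2 b in
  let s3 := n1 b + nhi b + n2 b + nlo b in
  [:: s1; s2; s3; extract_bit b l] ++
  (if l <= n1 b then [::]
   else if l <= s1 then
     [:: l - n1 b; nhi b - (l - n1 b); divz (ghi b) (p2 (nhi b - (l - n1 b)))]
   else if l <= s2 then [::]
   else if l <= s3 then
     [:: l - n1 b; l - n1 b - nhi b; l - n1 b - nhi b - n2 b;
         nlo b - (l - n1 b - nhi b - n2 b);
         divz (glo b) (p2 (nlo b - (l - n1 b - nhi b - n2 b)))]
   else [::]).

Definition repr_signed (w : nat) (z : int) : bool :=
  (- (2 ^ w.-1)%N%:Z <= z) && (z < (2 ^ w.-1)%N%:Z).

Definition binval (R : realType) (s : seq int) : R :=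
  \sum_(i < size s) (s`_i)%:~R / 2 ^+ i.+1.

(* (0. b1^{n1} s)_2 ; when n1 < 0 (only possible for E = 1) the string s
   is read as starting at position n1 + 1, i.e. shifted by 2^(-n1). *)
Definition binstr (R : realType) (n1 : int) (b1 : int) (s : seq int) : R :=
  if 0 <= n1 then binval R (nseq (absz n1) b1 ++ s)
  else (2 : R) ^ (- n1) * binval R s.

Definition pre1_string (R : realType) (b : pre1_out) : R :=
  binstr R (n1 b) (b1 b)
    (bits (ghi b) (nhi b) ++ nseq (absz (n2 b)) (b2 b) ++ bits (glo b) (nlo b)).

(* d is the concise binary expansion of y: y = (0.d_0 d_1 d_2 ...)_2,
   i.e. sum_i d_i 2^-(i+1) = y, and d does not end in infinitely many 1s.
   The l-th digit after the binary point is d (l-1). *)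
Definition concise_expansion (R : realType) (y : R) (d : nat -> bool) : Prop :=
  (series (fun i : nat => (d i : nat)%:R / (2 : R) ^+ i.+1) @ \oo --> (y : R^o))
  /\ ~ (exists N : nat, forall i : nat, (N <= i)%N -> d i).

(* Main.v *)
(** With [B = 2^(E-1) - 1] and [a = max(e, 1)], a nonnegative float is
    [f * 2^a / 2^(B+m)] for its integer significand [f], subnormal or not.
    Hence [x - x' = G / 2^N] with [G = f * 2^d - f'], [d = a - a'] and
    [N = B + m - a'].  Dividing [f'] by [2^d] with a borrow [b2] splits [G] into
    the blocks [ghi], [b2 ... b2], [glo] of widths [nhi], [n2], [nlo], so the
    binary digits of [G] are those of the concatenated string.  A concise
    expansion is unique because its first digit decides whether [1 <= 2 * y] and
    its tail is a concise expansion of [2 * y] minus that digit; so it is the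
    terminating one read off from [G]. *)
Require Import Defs.
From HB Require Import structures.
From mathcomp Require Import all_boot all_order all_algebra.
From mathcomp Require Import all_classical all_reals all_analysis.
From mathcomp Require Import zify ring lra.
Import Order.TTheory GRing.Theory Num.Theory numFieldNormedType.Exports.
Set Implicit Arguments. Unset Strict Implicit. Unset Printing Implicit Defensive.
Local Open Scope ring_scope.

(** * Partial sums and uniqueness of concise binary expansions *)

Lemma binary_series_bounds (R : realType) (d : nat -> bool) (n : nat) :
  0 <= series (fun i => (d i : nat)%:R / (2 : R) ^+ i.+1) n <= 1 - 2^-1 ^+ n.
Proof.
elim: n => [|n /andP[IH0 IH1]]; first by rewrite /series /= big_geq // expr0 subrr lexx.
have hn : 0 < (2^-1 : R) ^+ n by apply: exprn_gt0; rewrite invr_gt0.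
rewrite seriesSr /= -exprVn !exprS.
by case: (d n) => /=; apply/andP; split; lra.
Qed.

(** The all-ones string has partial sums [1 - 2^-n], and a zero at [i] costs [2^-(i+1)] for good;
    this gap survives the limit and keeps a concise expansion strictly below 1. *)
Lemma binary_series_lt (R : realType) (d : nat -> bool) (i n : nat) :
  ~~ d i -> (i < n)%N ->
  series (fun i => (d i : nat)%:R / (2 : R) ^+ i.+1) n
    <= 1 - 2^-1 ^+ i.+1 - 2^-1 ^+ n.
Proof.
move=> /negbTE di; elim: n => // n IH; rewrite ltnS leq_eqVlt => /orP[/eqP<-|lt_in].
  have /andP[_] := binary_series_bounds R d i.
  by rewrite seriesSr /= di mul0r addr0 !exprS; lra.
have hn : 0 < (2^-1 : R) ^+ n by apply: exprn_gt0; rewrite invr_gt0.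
have := IH lt_in; rewrite seriesSr /= -exprVn !exprS.
by case: (d n) => /=; lra.
Qed.

Lemma concise_expansion_itv (R : realType) (y : R) (d : nat -> bool) :
  concise_expansion y d -> 0 <= y < 1.
Proof.
move=> [cy nd].
have [i di] : exists i, ~~ d i.
  apply: contrapT => H; apply: nd; exists 0%N => i _.
  by apply: contrapT => /negP Hi; apply: H; exists i.
apply/andP; split.
  by apply: (cvgr_to_ge cy); apply: nearW => n; have /andP[] := binary_series_bounds R d n.
have hi : 0 < (2^-1 : R) ^+ i.+1 by apply: exprn_gt0; rewrite invr_gt0.
apply: (@le_lt_trans _ _ (1 - 2^-1 ^+ i.+1)); last by lra.
apply: (cvgr_to_le cy); exists i.+1 => // n /= /(binary_series_lt R di).
have hn : 0 < (2^-1 : R) ^+ n by apply: exprn_gt0; rewrite invr_gt0.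
lra.
Qed.

Lemma concise_expansion_behead (R : realType) (y : R) (d : nat -> bool) :
  concise_expansion y d ->
  concise_expansion (2 * y - (d 0%N : nat)%:R) (fun i => d i.+1).
Proof.
move=> [cy nd]; split; last first.
  by move=> [N HN]; apply: nd; exists N.+1 => -[|i] //; exact: HN.
(* Doubling moves the point one place right, so the tail's partial sums come from those with one
   more term. *)
rewrite [X in (X @ _)%classic](_ : _ = fun n =>
   2 * series (fun i => (d i : nat)%:R / (2 : R) ^+ i.+1) n.+1 - (d 0%N : nat)%:R); last first.
  apply/funext => n; rewrite /series /= big_nat_recl // mulrDr mulr_sumr expr1.
  rewrite mulrCA divff // mulr1 addrAC subrr add0r.
  apply: eq_bigr => i _; rewrite [in RHS]exprS invfM; field.
  by rewrite expf_neq0.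
apply: cvgB; last exact: cvg_cst.
apply: cvgM; first exact: cvg_cst.
by rewrite (cvg_shiftS (series _)).
Qed.

Lemma concise_expansion_unique (R : realType) (y : R) (d d' : nat -> bool) :
  concise_expansion y d -> concise_expansion y d' -> d =1 d'.
Proof.
(* [y] is generalised because the tails expand a different number. *)
move=> + + i; elim: i y d d' => [|i IH] y d d' cd cd'.
all: have := concise_expansion_itv (concise_expansion_behead cd).
all: have := concise_expansion_itv (concise_expansion_behead cd').
all: move=> /andP[h1 h2] /andP[h3 h4].
(* Both [2 * y - d 0] and [2 * y - d' 0] lie in [[0, 1)], so the two bits differ by less than 1. *)
all: have e0 : d 0%N = d' 0%N by
  move: h1 h2 h3 h4; case: (d 0%N); case: (d' 0%N) => //=; lra.
  by [].
have /= := concise_expansion_behead cd'; rewrite -e0.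
exact: (IH _ (fun j => d j.+1) (fun j => d' j.+1)) (concise_expansion_behead cd).
Qed.

(** * Terminating expansions of dyadic rationals *)

Definition dyadic_digit (G N i : nat) : bool :=
  (i < N)%N && odd (G %/ 2 ^ (N - i.+1)).

(** Appending a digit doubles the truncated quotient and adds a parity bit, so the induction runs
    over all prefixes; [n = N] gives the full value. *)
Lemma dyadic_digits_sum (R : realType) (G N n : nat) : (n <= N)%N ->
  (G < 2 ^ N)%N ->
  \sum_(0 <= i < n) (dyadic_digit G N i : nat)%:R / (2 : R) ^+ i.+1
    = (G %/ 2 ^ (N - n))%:R / 2 ^+ n.
Proof.
move=> + ltG; elim: n => [|n IH] lenN.
  by rewrite big_geq // subn0 divn_small // mul0r.
rewrite big_nat_recr //= IH; last exact: ltnW.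
rewrite /dyadic_digit lenN /=.
have -> : (N - n = (N - n.+1).+1)%N by lia.
rewrite expnSr divnMA; set q := (G %/ _)%N.
rewrite -[in RHS](odd_double_half q) divn2 natrD -muln2 natrM exprS.
field.
by rewrite expf_neq0.
Qed.

Lemma dyadic_concise_expansion (R : realType) (G N : nat) : (G < 2 ^ N)%N ->
  concise_expansion (G%:R / (2 : R) ^+ N) (dyadic_digit G N).
Proof.
move=> ltG; split; last first.
  (* At index [maxn M N] the cutoff in [dyadic_digit] gives a zero, against a tail of ones. *)
  move=> [M /(_ (maxn M N))]; rewrite leq_maxl /dyadic_digit => /(_ isT).
  by rewrite ltnNge leq_maxr.
apply: (@cvg_near_cst _ R^o); exists N => // n /= leNn.
rewrite /series /= (big_cat_nat (leq0n N) leNn) /= dyadic_digits_sum // subnn divn1.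
rewrite big_nat_cond big1 ?addr0 // => i /andP[/andP[lei _] _].
by rewrite /dyadic_digit ltnNge lei mul0r.
Qed.

(** * Binary digits of concatenated blocks *)

Lemma divn_MDr_pow2 (q r n k : nat) : (n <= k)%N -> (r < 2 ^ n)%N ->
  ((q * 2 ^ n + r) %/ 2 ^ k = q %/ 2 ^ (k - n))%N.
Proof.
move=> lenk ltr; rewrite -[in LHS](subnKC lenk) expnD divnMA.
by rewrite divnMDl ?expn_gt0 // (divn_small ltr) addn0.
Qed.

(** Below the cut [n] the upper block adds an even number to the quotient, which parity ignores. *)
Lemma odd_divn_MDr_pow2 (q r n k : nat) : (k < n)%N ->
  odd ((q * 2 ^ n + r) %/ 2 ^ k) = odd (r %/ 2 ^ k).
Proof.
move=> ltkn; rewrite -(subnKC ltkn) expnD expnS.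
rewrite (_ : q * _ = (q * 2 ^ (n - k.+1) * 2) * 2 ^ k)%N; last by ring.
by rewrite divnMDl ?expn_gt0 // oddD oddM andbF.
Qed.

(** [2^n - 1] is a run of ones, which is what a borrow leaves when it crosses a block of zeros. *)
Lemma odd_divn_pow2_pred (n k : nat) : (k < n)%N -> odd ((2 ^ n - 1) %/ 2 ^ k).
Proof.
move=> ltkn.
have -> : (2 ^ n - 1 = (2 ^ (n - k) - 1) * 2 ^ k + (2 ^ k - 1))%N.
  rewrite mulnBl mul1n -expnD subnK ?(ltnW ltkn) //.
  have := leq_pexp2l (isT : (0 < 2)%N) (ltnW ltkn); have := expn_gt0 2 k; lia.
rewrite divn_MDr_pow2 ?subnn ?divn1 //; last by have := expn_gt0 2 k; lia.
by rewrite oddB ?expn_gt0 // oddX subn_eq0 leqNgt ltkn.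
Qed.

(** * Values of digit strings *)

Lemma binval_cat (R : realType) (s t : seq int) :
  binval R (s ++ t) = binval R s + binval R t / 2 ^+ size s.
Proof.
rewrite /binval size_cat big_split_ord /= mulr_suml; congr (_ + _); apply: eq_bigr => i _.
  by rewrite nth_cat ltn_ord.
rewrite nth_cat ltnNge leq_addr /= addKn -addnS exprD invfM.
by rewrite -mulrA [X in _ * X]mulrC.
Qed.

Lemma binval_nseq (R : realType) (n : nat) (b : int) :
  binval R (nseq n b) = b%:~R * (1 - 2 ^- n).
Proof.
elim: n => [|n IH]; first by rewrite /binval big_ord0 expr0 invr1 subrr mulr0.
rewrite -addn1 nseqD binval_cat IH size_nseq /binval big_ord1 /= addn1 !exprS expr0; field.
by rewrite expf_neq0.
Qed.

Lemma digit_nat (g k j : nat) : (j <= k)%N ->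
  digit g%:Z k%:Z j%:Z = (odd (g %/ 2 ^ (k - j)) : nat)%:Z.
Proof.
by move=> lejk; rewrite /digit subzn // /p2 /= divz_nat modz_nat modn2.
Qed.

Lemma binval_bits (R : realType) (g k : nat) : (g < 2 ^ k)%N ->
  binval R (bits g%:Z k%:Z) = g%:R / 2 ^+ k.
Proof.
move=> ltg; rewrite /binval /bits size_map size_iota /=.
have := dyadic_digits_sum R (leqnn k) ltg; rewrite subnn divn1 => <-.
rewrite big_mkord; apply: eq_bigr => i _.
rewrite (nth_map 0%N) ?size_iota // nth_iota // add0n digit_nat //.
by rewrite /dyadic_digit ltn_ord.
Qed.

(** * Floats as scaled integers, and their subtraction with borrow *)

Definition significand (m e F : nat) : nat :=
  if e == 0%N then F else (2 ^ m + F)%N.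

Lemma biasE (E : nat) : bias E = (2 ^ E.-1 - 1)%N%:Z.
Proof. by rewrite /bias -subzn // expn_gt0. Qed.

Lemma fval_ge0E (R : realType) (E m : nat) (s : bool) (e F : nat) :
  0 <= fval R E m s e F ->
  fval R E m s e F =
    (significand m e F * 2 ^ maxn e 1)%N%:R / 2 ^+ (2 ^ E.-1 - 1 + m).
Proof.
rewrite /fval biasE; set B := (2 ^ E.-1 - 1)%N; set v := (X in _ * X).
have -> : v = (significand m e F * 2 ^ maxn e 1)%N%:R / 2 ^+ (B + m).
  rewrite /v /significand natrM natrX exprD; case: eqP => [->|/eqP e0].
    rewrite (_ : maxn 0 1 = 1%N) // expfzDr // expr1z -exprnN expr1; field.
    by rewrite !expf_neq0.
  have -> : maxn e 1 = e by lia.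
  rewrite expfzDr // -exprnP -exprnN; field.
  by rewrite !expf_neq0.
set w := (X in _ * X) => wge0.
have w0 : 0 <= w by rewrite /w divr_ge0 ?ler0n ?exprn_ge0.
(* A set sign bit is still possible for the value 0, so absolute values are compared. *)
by rewrite -(ger0_norm wge0) normrM normr_sign mul1r ger0_norm.
Qed.

(** Schoolbook subtraction: a nonzero [flo] borrows one from the upper part. If [d <= m+1] there is
    no middle block; otherwise all of [f'] lies below it and the borrow turns its [n2] zeros into
    ones. The cap [k] stands for [E + m]: once it is reached the quotient is already 0, as
    [f' < 2^(m+1)]. *)
Lemma subn_shift_split (k m f f' d : nat) :
  (m < k)%N -> (f' < 2 ^ m.+1)%N -> (f' < f * 2 ^ d)%N ->
  let fhi := (f' %/ 2 ^ minn d k)%N in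
  let nlo := minn d m.+1 in
  let flo := (f' %% 2 ^ nlo)%N in
  let b := (0 < flo)%N in
  let n2 := (d - m.+1)%N in
  [/\ (fhi + b <= f)%N, (flo <= b * 2 ^ nlo)%N, (b * 2 ^ nlo - flo < 2 ^ nlo)%N &
   (f * 2 ^ d - f' = ((f - fhi - b) * 2 ^ n2 + b * (2 ^ n2 - 1)) * 2 ^ nlo
                      + (b * 2 ^ nlo - flo))%N].
Proof.
move=> ltmk ltf' ltx; cbv zeta.
have [led|ltd] := leqP d m.+1.
  have -> : minn d k = d by lia.
  have -> : (d - m.+1 = 0)%N by lia.
  move: ltx; rewrite [in (f' < _)%N](divn_eq f' (2 ^ d)).
  rewrite [in (_ - f')%N](divn_eq f' (2 ^ d)).
  have : (f' %% 2 ^ d < 2 ^ d)%N by rewrite ltn_pmod // expn_gt0.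
  rewrite expn0.
  move: (2 ^ d)%N (f' %% 2 ^ d)%N (f' %/ 2 ^ d)%N => K r q ltr ltx.
  have ltq : (q < f)%N by rewrite -(@ltn_pmul2r K); lia.
  (* [q < f] leaves room for the borrow; the witness [t] removes truncated subtraction before
     [nia]. *)
  have [t ->] : exists t, f = (q + 1 + t)%N by exists (f - q - 1)%N; lia.
  by split; case: r ltr ltx => [|r] /= ltr ltx; nia.
have lemn : (m.+1 <= minn d k)%N by lia.
rewrite divn_small; last by apply: leq_trans ltf' _; rewrite leq_exp2l.
rewrite modn_small //.
have -> : (2 ^ d = 2 ^ (d - m.+1) * 2 ^ m.+1)%N by rewrite -expnD subnK // ltnW.
have f0 : (0 < f)%N by case: f ltx.
have := expn_gt0 2 (d - m.+1); move: (2 ^ (d - m.+1))%N (2 ^ m.+1)%N ltf' => P Q ltf' P0.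
have [t ->] : exists t, f = t.+1 by exists f.-1; lia.
have [p ->] : exists p, P = p.+1 by exists P.-1; lia.
by split; case: f' {ltx} ltf' => [|r] /= ltr; nia.
Qed.

(** * Digits and value of the output string *)

Lemma extract_bit_nat (z : int) (n2 nhi nlo N A C l : nat) (b : bool) :
  (A < 2 ^ nhi)%N -> (C < 2 ^ nlo)%N -> (0 < l)%N ->
  z + nhi%:Z + n2%:Z + nlo%:Z = N%:Z ->
  extract_bit (Pre1Out z n2 nhi nlo 0 (b : nat) A C) l =
  (dyadic_digit ((A * 2 ^ n2 + b * (2 ^ n2 - 1)) * 2 ^ nlo + C) N l.-1 : nat)%:Z.
Proof.
move=> ltA ltC l0 HN; rewrite /extract_bit /= /dyadic_digit prednK //.
have ltB : (b * (2 ^ n2 - 1) < 2 ^ n2)%N.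
  by have := expn_gt0 2 n2; case: (b); lia.
case: leP => [lz|ltz].
  (* Here the digit has weight at least [2^(nhi + n2 + nlo)], above every block. *)
  rewrite !divn_MDr_pow2 //; [|lia..].
  rewrite divn_small ?andbF //; apply: leq_trans ltA _.
  by rewrite leq_exp2l //; lia.
case: leP => [ls1|lts1].
  (* [z] may be negative, as [n1] is when [E = 1], so the position is formed in the integers. *)
  have -> : l%:Z - z = (absz (l%:Z - z)%R)%:Z by lia.
  rewrite digit_nat; last by lia.
  have -> : (l <= N)%N by lia.
  rewrite !divn_MDr_pow2 //=; [|lia..].
  by do 5 f_equal; lia.
case: leP => [ls2|lts2].
  have -> : (l <= N)%N by lia.
  rewrite divn_MDr_pow2 //=; last by lia.
  rewrite odd_divn_MDr_pow2; last by lia.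
  by case: (b); rewrite ?mul0n ?div0n // mul1n odd_divn_pow2_pred //; lia.
(* Past position [N] the cutoff in [dyadic_digit] matches the default 0; without it [N - l] would
   truncate to 0 and give the last bit again. *)
case: leP => [ls3|lts3]; last by rewrite (_ : (l <= N)%N = false) //; lia.
have -> : l%:Z - z - nhi%:Z - n2%:Z = (absz (l%:Z - z - nhi%:Z - n2%:Z)%R)%:Z by lia.
rewrite digit_nat; last by lia.
have -> : (l <= N)%N by lia.
rewrite odd_divn_MDr_pow2 /=; last by lia.
by do 5 f_equal; lia.
Qed.

Lemma pre1_string_nat (R : realType) (z : int) (n2 nhi nlo N A C : nat) (b : bool) :
  (A < 2 ^ nhi)%N -> (C < 2 ^ nlo)%N ->
  z + nhi%:Z + n2%:Z + nlo%:Z = N%:Z ->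
  pre1_string R (Pre1Out z n2 nhi nlo 0 (b : nat) A C) =
  ((A * 2 ^ n2 + b * (2 ^ n2 - 1)) * 2 ^ nlo + C)%N%:R / 2 ^+ N.
Proof.
move=> ltA ltC HN; rewrite /pre1_string /=.
(* Leading zeros only scale by [2^-z], which is also the convention for negative [z]. *)
have binstr0 (t : seq int) : binstr R z 0 t = 2 ^ (- z) * binval R t.
  rewrite /binstr; case: ifP => // z0.
  rewrite binval_cat binval_nseq mul0r add0r size_nseq mulrC.
  by rewrite -[in RHS](gez0_abs z0) exprnN.
rewrite binstr0 !binval_cat !binval_bits // binval_nseq.
rewrite /bits size_map size_iota size_nseq /=.
have -> : 2 ^+ N = 2 ^ z * 2 ^+ nhi * 2 ^+ n2 * 2 ^+ nlo :> R.
  by rewrite !exprnP -!expfzDr // HN.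
rewrite -invr_expz !natrD !natrM !natrD !natrM natrB ?expn_gt0 // !natrX.
field.
by rewrite !expf_neq0 // expfz_neq0.
Qed.

(** * [Pre1] computed in natural numbers *)

Lemma ehatE (E e : nat) : ehat E e = (maxn e 1)%:Z - (2 ^ E.-1 - 1)%N%:Z.
Proof. by rewrite /ehat biasE /ind; case: e => [|e] /=; lia. Qed.

Lemma ehat'E (E e : nat) : ehat' E e = (maxn e 1)%:Z - (2 ^ E.-1 - 1)%N%:Z.
Proof. exact: ehatE. Qed.

Lemma fintE (m e F : nat) : fint m e F = (significand m e F)%:Z.
Proof. by rewrite /fint /significand /ind; case: eqP => _ /=; lia. Qed.

Lemma fint'E (m e F : nat) : fint' m e F = (significand m e F)%:Z.
Proof. exact: fintE. Qed.

Lemma ddE (E e e' : nat) : (maxn e' 1 <= maxn e 1)%N ->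
  dd E e e' = (maxn e 1 - maxn e' 1)%N%:Z.
Proof. by move=> lea; rewrite /dd ehat'E ehatE; lia. Qed.

Lemma significand_lt (m e F : nat) : (F < 2 ^ m)%N ->
  (significand m e F < 2 ^ m.+1)%N.
Proof. by rewrite /significand expnS; case: eqP => _; lia. Qed.

(** [d >= 0] makes the minima and the maximum natural, and the bounds of [subn_shift_split] keep the
    subtractions in [ghi] and [glo] from truncating. *)
Lemma pre1_nat (E m : nat) (one : bool) (e F e' F' : nat) :
  (0 < E)%N -> (F' < 2 ^ m)%N -> (maxn e' 1 <= maxn e 1)%N ->
  let f := significand m e F in
  let f' := significand m e' F' in
  let d := (maxn e 1 - maxn e' 1)%N in
  let nlo := minn d m.+1 in
  let fhi := (f' %/ 2 ^ minn d (E + m))%N in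
  let flo := (f' %% 2 ^ nlo)%N in
  let b := (0 < flo)%N in
  (f' < f * 2 ^ d)%N ->
  [/\ shi E m e e' = (minn d (E + m))%N%:Z,
      fhi' E m e e' F' = fhi%:Z,
      flo' E m e e' F' = flo%:Z
    & pre1 E m one e F e' F' =
      Pre1Out ((2 ^ E.-1 - 1)%N%:Z - (maxn e 1)%:Z - 1 + (one : nat)%:Z)
        (d - m.+1)%N (m + ~~ one)%N nlo 0 (b : nat)
        (f - fhi - b)%N (b * 2 ^ nlo - flo)%N].
Proof.
move=> E0 ltF' lea f f' d nlo fhi flo b ltx.
have ltf' : (f' < 2 ^ m.+1)%N by exact: significand_lt.
have ltm : (m < E + m)%N by lia.
have [lef leflo _ _] := subn_shift_split ltm ltf' ltx.
have dE : dd E e e' = d%:Z by exact: ddE.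
have shiE : shi E m e e' = (minn d (E + m))%N%:Z by rewrite /shi dE; move: (d) => k; clear; lia.
have sloE : slo E m e e' = nlo%:Z by rewrite /slo dE /nlo; move: (d) => k; clear; lia.
have fhiE : fhi' E m e e' F' = fhi%:Z.
  by rewrite /fhi' shiE fint'E /p2 /= divz_nat.
have floE : flo' E m e e' F' = flo%:Z.
  by rewrite /flo' sloE fint'E /p2 /= modz_nat.
split=> //; rewrite /pre1; congr Pre1Out.
- by rewrite /pn1 ehatE /ind; lia.
- by rewrite /pn2 dE; move: (d) => k; clear; lia.
- by rewrite /pnhi /ind; case: (one); clear; lia.
- exact: sloE.
- by rewrite /pb2 floE.
- rewrite /pghi /pb2 fhiE floE fintE /ind -subnDA -subzn; [|exact: lef].
  by rewrite PoszD opprD addrA.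
- rewrite /pglo /pb2 /pnlo floE sloE /ind /p2 /= -subzn; [|exact: leflo].
  by rewrite PoszM.
Qed.

(** * Ranges of the intermediate values *)

Lemma pre1_intermediates_repr (E m : nat) (one : bool) (e F e' F' : nat) :
  (0 < E)%N -> (0 < m)%N ->
  (e < 2 ^ E - 1)%N -> (F < 2 ^ m)%N -> (e' < 2 ^ E - 1)%N -> (F' < 2 ^ m)%N ->
  (maxn e' 1 <= maxn e 1 <= 2 ^ E.-1)%N ->
  (significand m e' F' < significand m e F * 2 ^ (maxn e 1 - maxn e' 1))%N ->
  all (repr_signed (1 + E + m)) (pre1_intermediates E m one e F e' F').
Proof.
move=> E0 m0 lte ltF lte' ltF' /andP[lea leP] ltx.
have ltf' := significand_lt e' ltF'.
have ltm : (m < E + m)%N by lia.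
have [lef leflo ltlo _] := subn_shift_split ltm ltf' ltx.
have [shiE fhiE floE preE] := pre1_nat one E0 ltF' lea ltx.
have n1E : pn1 E one e = _ := congr1 n1 preE.
have n2E : pn2 E m e e' = _ := congr1 n2 preE.
have nhiE : pnhi m one = _ := congr1 nhi preE.
have nloE : slo E m e e' = _ := congr1 nlo preE.
have b2E : pb2 E m e e' F' = _ := congr1 b2 preE.
have ghiE : pghi E m e F e' F' = _ := congr1 ghi preE.
have gloE : pglo E m e e' F' = _ := congr1 glo preE.
rewrite /= {preE} in n1E n2E nhiE nloE b2E ghiE gloE.
rewrite /pre1_intermediates /pnlo.
rewrite !gloE !ghiE !b2E !nhiE !n2E !nloE !n1E !shiE !fhiE !floE.
rewrite !ehat'E !ehatE !fint'E !fintE !ddE // biasE /pb1 /p2 [absz _]/=.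
move: ltlo leflo lef {n1E n2E nhiE nloE b2E ghiE gloE shiE fhiE floE}.
have := significand_lt e ltF; move: ltf'; rewrite expnS.
move: {ltx ltF ltF'} (significand m e F) (significand m e' F') => f f'.
have := leq_div f' (2 ^ minn (maxn e 1 - maxn e' 1) (E + m)).
have := leq_mod f' (2 ^ minn (maxn e 1 - maxn e' 1) m.+1).
have : (maxn e 1 - maxn e' 1 = 0 -> f' %% 2 ^ minn (maxn e 1 - maxn e' 1) m.+1 = 0)%N.
  by move=> ->; rewrite min0n modn1.
move: (f' %/ _)%N (f' %% _)%N => fhi flo.
have : (2 ^ minn (maxn e 1 - maxn e' 1) m.+1 <= 2 * 2 ^ m)%N.
  by rewrite -expnS leq_exp2l //; lia.
move: (2 ^ minn _ _)%N => K.
have Qm : (m < 2 ^ m)%N by exact: ltn_expl.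
have Q2 : (2 <= 2 ^ m)%N by rewrite -{1}(expn1 2) leq_exp2l.
have TE : (2 ^ (E + m) = 2 * 2 ^ E.-1 * 2 ^ m)%N.
  by rewrite expnD -{1}(prednK E0) expnS.
have P0 : (0 < 2 ^ E.-1)%N by rewrite expn_gt0.
have EP : (2 ^ E = 2 * 2 ^ E.-1)%N by rewrite -{1}(prednK E0) expnS.
rewrite {}EP in lte lte'.
rewrite /repr_signed -[(1 + E + m).-1]/(E + m)%N {}TE.
move: (2 ^ E.-1)%N (2 ^ m)%N Qm Q2 P0 lte lte' leP => P Q Qm Q2 P0 lte lte' leP.
(* [2 * P * Q] is [2^(E+m)], where [P = 2^(E-1)] and [Q = 2^m]; linear lower bounds replace the
   product for [lia]. *)
have [T0 T1 T2] : [/\ (2 * P * Q >= 4 * P)%N, (2 * P * Q >= 2 * Q)%N &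
   (2 <= P)%N -> (2 * P * Q >= 4 * Q)%N] by split; nia.
have T3 : (2 * P * Q >= 2 * (P + Q) - 2)%N by nia.
move: (2 * P * Q)%N T0 T1 T2 T3 => T T0 T1 T2 T3 leK d0 leflo lefhi ltf' ltf ltlo leflo' lef.
have leb : ((0 < flo) * K <= 2 * Q)%N by case: (0 < flo)%N leK; rewrite ?mul1n ?mul0n.
(* If [flo > 0] then [d > 0], hence [2 <= maxn e 1 <= P] and [T >= 4 * Q]; otherwise the product is
   0. The bound [2 * Q] alone would not be strict for [P = 1]. *)
have bK : ((0 < flo) * K < T)%N by case: (flo) d0 leb => [|flo0] /= d0 leb; lia.
move: bK leb ltlo leflo' lef; rewrite -PoszM.
move: (_ * K)%N => bK.
have := leq_b1 (0 < flo)%N.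
move: (nat_of_bool (0 < flo)%N) => b.
have := leq_b1 one.
have : (one + ~~ one = 1)%N by case: (one).
move: (nat_of_bool one) (nat_of_bool (~~ one)) => o no ono o1 b1 bKT leb ltlo leflo' lef.
rewrite {d0}.
move: (maxn e 1) (maxn e' 1) (leq_maxl e 1) (leq_maxl e' 1) (leq_maxr e 1)
  (leq_maxr e' 1) lea leP => a a' *.
do ![apply/andP; split] => //; lia.
Qed.

(** The branch guards bound every offset of [l] by block widths, and a quotient is at most its
    dividend, so only [A], [C], [N] and the total width need bounds, besides the sign of
    [z + nhi]. *)
Lemma extract_intermediates_repr (w : nat) (z : int) (n2 nhi nlo N A C l : nat)
    (b : bool) :
  (A < 2 ^ nhi)%N -> (C < 2 ^ nlo)%N -> (0 < l)%N -> (0 < w)%N ->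
  z + nhi%:Z + n2%:Z + nlo%:Z = N%:Z -> 0 <= z + nhi%:Z ->
  (A < 2 ^ w)%N -> (C < 2 ^ w)%N -> (N < 2 ^ w)%N -> (nhi + n2 + nlo < 2 ^ w)%N ->
  all (repr_signed w.+1)
    (extract_intermediates (Pre1Out z n2 nhi nlo 0 (b : nat) A C) l).
Proof.
move=> ltA ltC l0 w0 HN s0 ltAw ltCw ltN ltn.
rewrite /extract_intermediates (extract_bit_nat _ ltA ltC l0 HN) /=.
set D := nat_of_bool (dyadic_digit _ _ _).
have D1 : (D <= 1)%N by exact: leq_b1.
have divE (G : nat) (k : int) : divz G (p2 k) = (G %/ 2 ^ absz k)%N%:Z.
  by rewrite /p2 divz_nat.
have w1 : (1 < 2 ^ w)%N by rewrite -{1}(expn0 2) ltn_exp2l.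
rewrite /repr_signed -[w.+1.-1]/w; move: (D) D1 => {}D D1.
rewrite !divE {divE ltA ltC}.
have := leq_div A (2 ^ absz (nhi%:Z - (l%:Z - z))%R).
have := leq_div C (2 ^ absz (nlo%:Z - (l%:Z - z - nhi%:Z - n2%:Z))%R).
move: (A %/ _)%N (C %/ _)%N (2 ^ w)%N ltAw ltCw ltN ltn w1 => A' C' W *.
case: ifP => lz /=; first by lia.
case: ifP => ls1 /=; first by lia.
case: ifP => ls2 /=; first by lia.
case: ifP => ls3 /=; by lia.
Qed.

(** A normal significand is at least [2^m] and every significand is below [2^(m+1)], so the smaller
    number cannot have the larger exponent, and [x <= 1] bounds [e] by the bias. The stated bound is
    one above the bias because [maxn 0 1] exceeds it when [E = 1]. *)
Lemma maxn1_exponent_le (E m e F e' F' : nat) : (F < 2 ^ m)%N ->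
  (significand m e F * 2 ^ maxn e 1 <= 2 ^ (2 ^ E.-1 - 1 + m))%N ->
  (significand m e' F' * 2 ^ maxn e' 1 < significand m e F * 2 ^ maxn e 1)%N ->
  (maxn e' 1 <= maxn e 1 <= 2 ^ E.-1)%N.
Proof.
move=> ltF lex ltx.
have normal_ge (k G : nat) : (0 < k)%N -> (2 ^ (m + k) <= significand m k G * 2 ^ k)%N.
  by case: k => // k _; rewrite expnD leq_mul2r /significand /= leq_addr orbT.
apply/andP; split.
  rewrite leqNgt; apply/negP => lta.
  have e'0 : (0 < e')%N by lia.
  have := normal_ge _ F' e'0; rewrite leqNgt => /negP; apply.
  have maxe' : maxn e' 1 = e' by lia.
  rewrite maxe' in ltx lta; apply: (leq_trans ltx).
  apply: (@leq_trans (2 ^ m.+1 * 2 ^ maxn e 1)%N).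
    by rewrite leq_mul2r ltnW ?orbT // significand_lt.
  by rewrite -expnD leq_exp2l //; lia.
have := expn_gt0 2 E.-1; case: (posnP e) => [->|e0] P0; first by lia.
have maxe : maxn e 1 = e by lia.
rewrite maxe in lex *.
by have := leq_trans (normal_ge _ F e0) lex; rewrite leq_exp2l //; lia.
Qed.

(** * From the constraints on [x] and [x'] to the blocks of [G] *)

Theorem theorem5p16 (R : realType) (E m : nat)
  (s : bool) (e F : nat) (s' : bool) (e' F' : nat) (l : nat) :
  (1 <= E)%N -> (1 <= m)%N ->
  (e < 2 ^ E - 1)%N -> (F < 2 ^ m)%N ->
  (e' < 2 ^ E - 1)%N -> (F' < 2 ^ m)%N ->
  let x := fval R E m s e F in
  let x' := fval R E m s' e' F' in
  0 <= x <= 1 -> 0 <= x' <= 1 -> 0 < x - x' < 1 ->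
  (1 <= l)%N ->
  let beta := pre1 E m (x == 1) e F e' F' in
  let b' := extract_bit beta l%:Z in
  [/\ 0 <= ghi beta /\ (ghi beta)%:~R < (2 : R) ^ nhi beta,
      0 <= glo beta /\ (glo beta)%:~R < (2 : R) ^ nlo beta,
      x - x' = pre1_string R beta,
      (exists d, concise_expansion (x - x') d) /\
        (forall d, concise_expansion (x - x') d -> b' = (d l.-1 : nat)%:Z)
    & all (repr_signed (1 + E + m)) (pre1_intermediates E m (x == 1) e F e' F')
      && all (repr_signed (1 + E + m)) (extract_intermediates beta l%:Z)].
Proof.
move=> E0 m0 lte ltF lte' ltF' x x' /andP[x0 x1] /andP[x'0 x'1] /andP[y0 y1] l0 beta b'.
have xE := fval_ge0E x0; have x'E := fval_ge0E x'0; rewrite -/x -/x' in xE x'E.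
have ltf := significand_lt e ltF; have ltf' := significand_lt e' ltF'.
have c0 : 0 < (2 : R) ^+ (2 ^ E.-1 - 1 + m) by exact: exprn_gt0.
have lex1 : (significand m e F * 2 ^ maxn e 1 <= 2 ^ (2 ^ E.-1 - 1 + m))%N.
  by move: x1; rewrite xE ler_pdivrMr // mul1r -natrX ler_nat.
have ltxx' : (significand m e' F' * 2 ^ maxn e' 1 < significand m e F * 2 ^ maxn e 1)%N.
  by move: y0; rewrite subr_gt0 xE x'E ltr_pM2r ?invr_gt0 // ltr_nat.
have /andP[lea' lea] := maxn1_exponent_le ltF lex1 ltxx'.
(* [x = 1] means [f * 2^a = 2^(B+m)] with [f < 2^(m+1)]; the resulting [B <= a] is all that is later
   used of [x = 1]. *)
have oneE : x == 1 -> (2 ^ E.-1 - 1 <= maxn e 1)%N.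
  rewrite xE => /eqP/(canRL (divfK (lt0r_neq0 c0))).
  rewrite mul1r -natrX => /eqP; rewrite eqr_nat => /eqP fE.
  have : (2 ^ (2 ^ E.-1 - 1 + m) < 2 ^ m.+1 * 2 ^ maxn e 1)%N.
    by rewrite -fE ltn_pmul2r // expn_gt0.
  by rewrite -expnD ltn_exp2l //; lia.
rewrite {}/b' {}/beta.
move: (x == 1) oneE => one oneE.
set f := significand m e F in xE ltf lex1 ltxx' *.
set f' := significand m e' F' in x'E ltf' ltxx' *.
set B := (2 ^ E.-1 - 1)%N in xE x'E c0 lex1 oneE *.
have PB : (2 ^ E.-1 = B.+1)%N by rewrite /B subn1 prednK // expn_gt0.
pose d := (maxn e 1 - maxn e' 1)%N.
pose N := (B + m - maxn e' 1)%N.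
have dE : (2 ^ maxn e 1 = 2 ^ d * 2 ^ maxn e' 1)%N by rewrite -expnD subnK.
(* [m >= 1] absorbs the one by which [maxn e 1] may exceed [B], so the truncated subtractions of
   exponents from [B + m] are exact. *)
have leaBm : (maxn e 1 <= B + m)%N.
  by apply: (leq_trans lea); rewrite PB -addn1 leq_add2l.
have NE : (2 ^ (B + m) = 2 ^ N * 2 ^ maxn e' 1)%N.
  by rewrite -expnD subnK // (leq_trans lea').
have ltx : (f' < f * 2 ^ d)%N.
  by move: ltxx'; rewrite dE mulnA ltn_pmul2r // expn_gt0.
pose G := (f * 2 ^ d - f')%N.
have yE : x - x' = G%:R / 2 ^+ N.
  rewrite xE x'E -!natrX NE dE /G natrB ?(ltnW ltx) // !natrM; field.
  by rewrite !natrX !expf_neq0.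
have ltG : (G < 2 ^ N)%N.
  by move: y1; rewrite yE ltr_pdivrMr ?exprn_gt0 // mul1r -natrX ltr_nat.
have ltm : (m < E + m)%N by rewrite -[X in (X < _)%N]add0n ltn_add2r.
have [lef leflo ltlo GE] := subn_shift_split ltm ltf' ltx.
have [_ _ _ ->] := pre1_nat one E0 ltF' lea' ltx.
have int_repr : all (repr_signed (1 + E + m)) (pre1_intermediates E m one e F e' F').
  by apply: pre1_intermediates_repr => //; rewrite lea' lea.
(* [B + 1 + m] bounds both [N] and the total width of the three blocks. *)
have ltBm : (B.+1 + m < 2 ^ (E + m))%N.
  rewrite expnD -(prednK E0) expnS PB.
  have : (m < 2 ^ m)%N by exact: ltn_expl.
  by move: (2 ^ m)%N => Q; clear; nia.
have le2 : (2 ^ m.+1 <= 2 ^ (E + m))%N by rewrite leq_exp2l.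
rewrite -/f -/f' -/d -/B; move: lef leflo ltlo GE.
set fhi := (f' %/ _)%N; set flo := (f' %% _)%N; set nlo := minn d m.+1.
move: fhi flo => fhi flo; move: (0 < flo)%N => b lef leflo ltlo GE.
set A := (f - fhi - b)%N in GE *; set C := (b * 2 ^ nlo - flo)%N in GE ltlo *.
have leA : (A <= f)%N := leq_trans (leq_subr _ _) (leq_subr _ _).
have dnE : (d - m.+1 + nlo = d)%N by rewrite /nlo; clear; lia.
have NdE : (N = B + m - maxn e 1 + d)%N.
  by move: leaBm lea'; rewrite /N /d; clear; lia.
have ltA : (A < 2 ^ (m + ~~ one))%N.
  (* For [x = 1] the top block is one digit shorter: [A * 2^d <= G < 2^N] and [B <= a] give
     [A < 2^m]. Otherwise [A <= f] is enough. *)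
  case: (one) oneE => oneE /=; last by rewrite addn1; exact: leq_ltn_trans leA ltf.
  have leAG : (A * 2 ^ d <= G)%N.
    rewrite /G GE -{1}dnE expnD mulnA; apply: (leq_trans _ (leq_addr _ _)).
    by rewrite leq_mul2r leq_addr orbT.
  have := leq_ltn_trans leAG ltG; rewrite NdE expnD ltn_pmul2r ?expn_gt0 //.
  move=> /leq_trans; apply; rewrite leq_exp2l //.
  by move: (oneE isT); clear; lia.
(* The indicator of [x = 1] cancels between [n1] and [nhi]. *)
have HN : (B%:Z - (maxn e 1)%:Z - 1 + (one : nat)%:Z) + (m + ~~ one)%N%:Z
          + (d - m.+1)%N%:Z + nlo%:Z = N%:Z.
  by move: dnE leaBm; rewrite NdE; clear; case: (one); lia.
rewrite {}/G GE in yE ltG; rewrite {}yE.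
have GN := dyadic_concise_expansion R ltG.
split.
- by split=> //=; rewrite -exprnP -natrX ltr_nat.
- by split=> //=; rewrite -exprnP -natrX ltr_nat.
- by rewrite (pre1_string_nat _ _ ltA ltlo HN).
- split; first by eexists; exact: GN.
  move=> dig /(concise_expansion_unique GN) <-.
  exact: extract_bit_nat.
rewrite int_repr /=; apply: (@extract_intermediates_repr _ _ _ _ _ N) => //.
- by rewrite addn_gt0 E0.
- by move: leaBm; clear; case: (one); lia.
- exact: leq_ltn_trans leA (leq_trans ltf le2).
- apply: (leq_trans ltlo); apply: leq_trans le2; rewrite leq_exp2l //.
  exact: geq_minr.
- by move: (2 ^ (E + m))%N ltBm => W; rewrite /N; move: (B) => B'; clear; lia.
- move: (2 ^ (E + m))%N ltBm dnE lea => W; rewrite PB /d.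
  by move: (B) (nlo) => B' n; clear; case: (one); lia.
Qed.
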